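(* Any protocol that calculates a Pareto Efficient and envy-free allocation for two players with submodular utility functions needs an exponential number of bits (exponential in the number $m$ of items).
   Context: There are $m$ indivisible items and two players. Each player $i\in\{1,2\}$ has a utility function $u_i$ assigning a value $u_i(S)$ to each subset $S\subseteq\{1,\dots,m\}$. There is a finite list of allowable allocations $A^{(1)},\dots,A^{(k)}$. Allocation $A^{(j)}$ gives player $i$ the bundle $A^{(j)}_i\subseteq\{1,\dots,m\}$, and the bundles of different players are disjoint. The allocation set is assumed to include all possible partitions of the items between the players. A mixed allocation is a probability vector $\mathbf p=(p_1,\dots,p_k)$ (with $p_j\ge 0$ and $\sum_j p_j=1$) on these allocations. Player $i$'s expected utility is $\sum_j p_j u_i(A^{(j)}_i)$. The allocation to be calculated is a mixed allocation. A mixed allocation $\mathbf p$ is Pareto Efficient if there is no other mixed allocation $\mathbf p'$ with $\sum_j p'_j u_i(A^{(j)}_i)\ge\sum_j p_j u_i(A^{(j)}_i)$ for all $i$ and strict inequality for some $i$. It is envy-free if $\sum_j p_j u_i(A^{(j)}_i)\ge\sum_j p_j u_i(A^{(j)}_{i'})$ for every pair of players $i,i'$. A function $u$ is submodular if and only if for any $X\subseteq Y$ and any element $e$, $u(X\cup\{e\})-u(X)\ge u(Y\cup\{e\})-u(Y)$. Communication setting: each player $i$ knows only her own utility function $u_i$ and has no knowledge of the other's utility function. For every $S$ and $i$, $u_i(S)$ is assumed to be representable with a polynomial number of bits. The quantity of interest is the minimum number of bits the players need to communicate with each other in order to calculate a Pareto Efficient and envy-free allocation, meaning that after communication and individual calculation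 every player agrees on one allocation that is both Pareto Efficient and envy-free. *)

(* Defs.v *)
From HB Require Import structures.
From mathcomp Require Import all_boot all_order all_algebra.
From mathcomp Require Import reals.

Set Implicit Arguments.
Unset Strict Implicit.
Unset Printing Implicit Defensive.

Import Order.TTheory GRing.Theory Num.Theory.
Local Open Scope ring_scope.

Definition player := 'I_2.

Definition allocation (m : nat) := player -> {set 'I_m}.

Definition disjoint_bundles m (B : allocation m) : Prop :=
  forall i i' : player, i != i' -> [disjoint B i & B i'].

Definition is_partition m (B : allocation m) : Prop :=
  disjoint_bundles B /\ \bigcup_(i : player) B i = [set: 'I_m].

(* Some items may be left unassigned by an allowable allocation, but every
   full partition of the items has to be on the list. *)
Definition allowable m k (A : 'I_k -> allocation m) : Prop :=
  (forall j, disjoint_bundles (A j)) /\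
  (forall B, is_partition B -> exists j, forall i, A j i = B i).

Definition utility (R : realType) (m : nat) := {ffun {set 'I_m} -> R}.

(* The element e may lie in Y; for e in Y but not in X the inequality says that
   adding e to X does not decrease u, so these functions are also monotone. *)
Definition submodular (R : realType) m (u : utility R m) : Prop :=
  forall (X Y : {set 'I_m}) (e : 'I_m), X \subset Y ->
    u (X :|: [set e]) - u X >= u (Y :|: [set e]) - u Y.

(* up_log 2 n.+1 is the number of binary digits of n (none for n = 0). *)
Definition nat_bits (n : nat) : nat := up_log 2 n.+1.

(* A sign bit, the numerator and the denominator in lowest terms. *)
Definition rat_bits (r : rat) : nat :=
  (1 + nat_bits `|numq r| + nat_bits `|denq r|)%N.

Definition representable (R : realType) m (b : nat) (u : utility R m) : Prop :=
  forall S, exists2 r : rat, u S = ratr r & (rat_bits r <= b)%N.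

Definition instance (R : realType) m (b : nat) (u : player -> utility R m) :=
  forall i, submodular (u i) /\ representable b (u i).

Definition mixed_allocation (R : realType) (k : nat) := {ffun 'I_k -> R}.

Definition is_probability (R : realType) k (p : mixed_allocation R k) : Prop :=
  (forall j, 0 <= p j) /\ \sum_j p j = 1.

(* Expected value, for the utility v, of the bundle that p gives to player i. *)
Definition expected (R : realType) m k (A : 'I_k -> allocation m)
    (p : mixed_allocation R k) (v : utility R m) (i : player) : R :=
  \sum_j p j * v (A j i).

Definition pareto_efficient (R : realType) m k (A : 'I_k -> allocation m)
    (u : player -> utility R m) (p : mixed_allocation R k) : Prop :=
  ~ exists p' : mixed_allocation R k,
      [/\ is_probability p',
          forall i, expected A p' (u i) i >= expected A p (u i) i
        & exists i, expected A p' (u i) i > expected A p (u i) i].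

Definition envy_free (R : realType) m k (A : 'I_k -> allocation m)
    (u : player -> utility R m) (p : mixed_allocation R k) : Prop :=
  forall i i' : player, expected A p (u i) i >= expected A p (u i) i'.

(* Deterministic two-party protocols, with private inputs in U. At Speak i f P1 P0
   player i announces the bit f (u i) and the play goes on with P1 (bit true) or
   P0 (bit false). When communication stops, each player i computes her result
   from the history and her own input only. *)
Inductive protocol (U O : Type) : Type :=
| Stop of (player -> U -> O)
| Speak of player & (U -> bool) & protocol U O & protocol U O.

Fixpoint result U O (P : protocol U O) (u : player -> U) (i : player) : O :=
  match P with
  | Stop g => g i (u i)
  | Speak s f P1 P0 => if f (u s) then result P1 u i else result P0 u i
  end.

Fixpoint bits_exchanged U O (P : protocol U O) (u : player -> U) : nat :=
  match P with
  | Stop _ => 0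
  | Speak s f P1 P0 =>
      (if f (u s) then bits_exchanged P1 u else bits_exchanged P0 u).+1
  end.

Definition calculates_PE_EF (R : realType) m k (A : 'I_k -> allocation m)
    (b : nat) (P : protocol (utility R m) (mixed_allocation R k)) : Prop :=
  forall u, instance b u ->
    exists p : mixed_allocation R k,
      [/\ forall i, result P u i = p, is_probability p,
          pareto_efficient A u p & envy_free A u p].

(* Main.v *)
(** Give both players the same utility
      u_G(S) = s (2m - s) + [S is G-good],   s = number of items of S among the first 2n,
    where n = m./2 and where exactly one of two complementary sets is G-good. The parameter
    G is any family of n-subsets of the first 2n items that avoid the first item, which
    leaves 2 ^ 'C(2n - 1, n) choices. The second differences of s (2m - s) are -2, which
    absorbs a 0/1 perturbation, so u_G is always submodular.
    When both players have u_G, the welfare of any allocation is at most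
    W = 2 n (2m - n) + 1, and envy-freeness equalizes the two expected values, so each is
    at most W / 2. If two families G, G' produced the same transcript on (u_G, u_G) and
    (u_G', u_G'), then the same lottery would be the answer for (u_G, u_G'), where it still
    gives each player at most W / 2. But G and G' differ on some set, and this yields a
    partition worth (W + 1) / 2 to each player, contradicting Pareto efficiency. Hence all
    2 ^ 'C(2n - 1, n) transcripts are distinct. *)
Require Import Defs.
From HB Require Import structures.
From mathcomp Require Import all_boot all_order all_algebra.
From mathcomp Require Import reals.
From mathcomp Require Import zify lra.

Set Implicit Arguments.
Unset Strict Implicit.
Unset Printing Implicit Defensive.

Import Order.TTheory GRing.Theory Num.Theory.
Local Open Scope ring_scope.

(** * Transcripts of two-party protocols *)

Fixpoint transcript U O (P : protocol U O) (u : player -> U) : seq bool :=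
  match P with
  | Stop _ => [::]
  | Speak s f P1 P0 =>
      f (u s) :: (if f (u s) then transcript P1 u else transcript P0 u)
  end.

(** Each bit depends on the input of a single speaker, so a profile that mixes [u] and [v] player by
    player follows their common path down the tree. *)
Lemma transcript_rectangle U O (P : protocol U O) (u v w : player -> U) :
  transcript P u = transcript P v -> (forall i, w i = u i \/ w i = v i) ->
  transcript P w = transcript P u.
Proof.
move=> uv wuv; elim: P uv => [//|s f P1 IH1 P0 IH0] /= [fuv].
have -> : f (w s) = f (u s) by case: (wuv s) => ->.
by rewrite -fuv; case: (f (u s)) => [/IH1|/IH0] ->.
Qed.

Lemma eq_result U O (P : protocol U O) (u v : player -> U) i :
  transcript P u = transcript P v -> u i = v i -> result P u i = result P v i.
Proof.
move=> uv ui; elim: P uv => [g _|s f P1 IH1 P0 IH0] /=; first by rewrite ui.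
by case=> <-; case: (f (u s)) => [/IH1|/IH0].
Qed.

(** Pigeonhole by descent in the protocol tree: the announced bit splits [F], and one part still
    exceeds [2 ^ b] while the budget drops from [b.+1] to [b]. *)
Lemma transcript_collision U O (I : finType) (x : I -> player -> U)
    (P : protocol U O) (b : nat) (F : {set I}) :
  (forall i, i \in F -> bits_exchanged P (x i) <= b)%N -> (2 ^ b < #|F|)%N ->
  exists i j, [/\ i \in F, j \in F, i != j &
                  transcript P (x i) = transcript P (x j)].
Proof.
elim: P b F => [g|s f P1 IH1 P0 IH0] b F bF cF.
  have /card_gt1P[i [j [iF jF ij]]] : (1 < #|F|)%N.
    by apply: leq_ltn_trans cF; rewrite expn_gt0.
  by exists i, j.
(* With budget 0, no input can reach a speaking node, but [F] is nonempty. *)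
case: b => [|b] in bF cF *.
  have /card_gt0P[i iF] : (0 < #|F|)%N by apply: leq_ltn_trans cF.
  by have := bF i iF.
pose F1 := [set i in F | f (x i s)]; pose F0 := [set i in F | ~~ f (x i s)].
have cF01 : #|F| = (#|F1| + #|F0|)%N.
  rewrite -(cardsID [set i | f (x i s)] F); congr (_ + _)%N; apply: eq_card => i.
    by rewrite !inE.
  by rewrite !inE andbC.
have [c1|c1] := ltnP (2 ^ b) #|F1|.
  have [|i [j [iF jF ij tij]]] := IH1 b F1 _ c1.
    by move=> i; rewrite inE => /andP[iF fi]; have := bF i iF; rewrite /= fi.
  move: iF jF; rewrite !inE => /andP[iF fi] /andP[jF fj].
  by exists i, j; split=> //=; rewrite fi fj tij.
have [||i [j [iF jF ij tij]]] := IH0 b F0.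
- move=> i; rewrite inE => /andP[iF /negbTE fi].
  by have := bF i iF; rewrite /= fi.
- by move: cF; rewrite cF01 expnS; lia.
move: iF jF; rewrite !inE => /andP[iF /negbTE fi] /andP[jF /negbTE fj].
by exists i, j; split=> //=; rewrite fi fj tij.
Qed.

(** * Lotteries forced by envy-freeness and Pareto efficiency *)

Definition profile U (x y : U) : player -> U := fun i => if i == ord0 then x else y.

(** On the profile [(x, y)], the first player sees what she sees on [(x, x)], the second what she
    sees on [(y, y)]. As the players agree on each result, all three profiles get the same
    lottery. *)
Lemma calculates_same_transcript (R : realType) m k (A : 'I_k -> allocation m)
    (b : nat) (P : protocol (utility R m) (mixed_allocation R k))
    (x y : utility R m) :
  calculates_PE_EF A b P ->
  instance b (profile x x) -> instance b (profile y y) ->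
  transcript P (profile x x) = transcript P (profile y y) ->
  exists p, [/\ is_probability p, envy_free A (profile x x) p,
    envy_free A (profile y y) p & pareto_efficient A (profile x y) p].
Proof.
move=> calc ix iy txy.
have ixy : instance b (profile x y).
  by move=> i; move: (ix i) (iy i); rewrite /profile; case: ifP.
have txyE : transcript P (profile x y) = transcript P (profile x x).
  apply: transcript_rectangle txy _ => i.
  by rewrite /profile; case: ifP; auto.
have [p [rp pp ep _]] := calc _ ixy.
have [px [rpx _ _ fx]] := calc _ ix.
have [py [rpy _ _ fy]] := calc _ iy.
have xE : px = p by rewrite -(rpx ord0) -(rp ord0); apply: eq_result.
have yE : py = p.
  rewrite -(rpy ord_max) -(rp ord_max); apply: eq_result => //.
  by rewrite txyE.
by exists p; split=> //; [rewrite -xE|rewrite -yE].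
Qed.

Lemma player_case (i : player) : i = ord0 \/ i = ord_max.
Proof. by case: i => [[|[|//]] hi]; [left|right]; apply: val_inj. Qed.

(** The two envy-freeness inequalities are opposite, so the expected values coincide, and their sum
    is an average of welfares bounded by [W]. *)
Lemma envy_free_common_utility (R : realType) m k (A : 'I_k -> allocation m)
    (v : utility R m) (p : mixed_allocation R k) (W : R) i :
  is_probability p -> envy_free A (profile v v) p ->
  (forall j, v (A j ord0) + v (A j ord_max) <= W) ->
  2 * expected A p v i <= W.
Proof.
move=> [p0 p1] ef hW.
have sumW : expected A p v ord0 + expected A p v ord_max <= W.
  rewrite -big_split -[W]mul1r -p1 mulr_suml; apply: ler_sum => j _ /=.
  by rewrite -mulrDr ler_wpM2l.
have e01 := ef ord0 ord_max; have e10 := ef ord_max ord0.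
rewrite /profile /= in e01 e10.
by case: (player_case i) => ->; lra.
Qed.

Lemma pareto_efficient_pure (R : realType) m k (A : 'I_k -> allocation m)
    (u : player -> utility R m) (p : mixed_allocation R k) j :
  pareto_efficient A u p -> ~ (forall i, expected A p (u i) i < u i (A j i)).
Proof.
move=> pe lt; apply: pe; exists [ffun l => (l == j)%:R].
have pureE (v : utility R m) i :
    expected A [ffun l => (l == j)%:R] v i = v (A j i).
  rewrite /expected (bigD1 j) //= ffunE eqxx mul1r big1 ?addr0 // => l /negbTE lj.
  by rewrite ffunE lj mul0r.
split; [split|by move=> i; rewrite pureE ltW|by exists ord0; rewrite pureE].
  by move=> l; rewrite ffunE ler0n.
rewrite (bigD1 j) //= ffunE eqxx big1 ?addr0 // => l /negbTE lj.
by rewrite ffunE lj.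
Qed.

(** * Submodular utilities with short descriptions *)

(** The coefficient [2 * m] keeps every marginal of the quadratic inside [M] at least 1, so the
    function stays monotone whatever [h] is. The natural subtraction never truncates. *)
Definition perturbed_quadratic m (M : {set 'I_m}) (h : {set 'I_m} -> bool)
    (S : {set 'I_m}) : nat :=
  (#|S :&: M| * (2 * m - #|S :&: M|) + h (S :&: M))%N.

Lemma submodular_perturbed_quadratic (R : realType) m (M : {set 'I_m}) h :
  submodular [ffun S => (perturbed_quadratic M h S)%:R : R].
Proof.
move=> X Y e XY; rewrite !ffunE lerBlDr addrAC lerBrDr -!natrD ler_nat.
rewrite /perturbed_quadratic.
have [eM|eM] := boolP (e \in M); last first.
  have UE (Z : {set 'I_m}) : (Z :|: [set e]) :&: M = Z :&: M.
    apply/setP => z; rewrite !inE; case: eqP => [->|_]; last by rewrite orbF.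
    by rewrite (negbTE eM) !andbF.
  by rewrite !UE addnC.
have UE (Z : {set 'I_m}) : (Z :|: [set e]) :&: M = e |: (Z :&: M).
  apply/setP => z; rewrite !inE; case: eqP => [->|_] //=; first by rewrite eM orbT.
  by rewrite orbF.
rewrite !UE; move: (X :&: M) (Y :&: M) (setSI M XY) => {}X {}Y {}XY.
rewrite !cardsU1.
have Xm : (#|X| <= m)%N by rewrite -[m in leqRHS]card_ord max_card.
have Ym : (#|e |: Y| <= m)%N by rewrite -[m in leqRHS]card_ord max_card.
rewrite cardsU1 in Ym.
have [eX|eX] := boolP (e \in X).
  have eY := subsetP XY e eX.
  by rewrite eY (setUidPr _) ?sub1set // (setUidPr _) ?sub1set //= addnC.
(* Equal cardinalities force equal sets; otherwise the marginals at [X] and [Y] are at least 2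
   apart, enough to absorb four values of [h]. *)
have [XYc|] := ltnP #|X| #|Y|; last first.
  move=> YX; have XE : X = Y by apply/eqP; rewrite eqEcard XY.
  by rewrite -XE eX addnC.
have incr z : (z < m)%N ->
    ((1 + z) * (2 * m - (1 + z)) = z * (2 * m - z) + (2 * m - 2 * z - 1))%N.
  move=> zm; have [d ->] : exists d, (m = z + 1 + d)%N by exists (m - z - 1)%N; lia.
  have -> : (2 * (z + 1 + d) - (1 + z) = z + 1 + 2 * d)%N by lia.
  have -> : (2 * (z + 1 + d) - z = z + 2 + 2 * d)%N by lia.
  have -> : (2 * (z + 1 + d) - 2 * z - 1 = 1 + 2 * d)%N by lia.
  by nia.
have Xlt : (#|X| < m)%N.
  by apply: leq_trans XYc _; apply: leq_trans Ym; apply: leq_addl.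
rewrite (incr _ Xlt).
(* For [e] in [Y] only monotonicity is at stake: the quadratic gains at least 1 and [h] loses at
   most 1. *)
have [eY|eY] := boolP (e \in Y).
  rewrite [e |: Y](setUidPr _) ?sub1set //= add0n.
  move: #|X| #|Y| Xlt => s t sm {XYc Ym}.
  by case: (h Y); case: (h X); case: (h (e |: X)) => /=; lia.
rewrite eY in Ym; rewrite (incr _ Ym).
move: #|X| #|Y| XYc Xlt Ym => s t st sm tm.
by case: (h Y); case: (h X); case: (h (e |: X)); case: (h (e |: Y)) => /=; lia.
Qed.

Lemma rat_bits_nat n : rat_bits n%:R = (2 + nat_bits n)%N.
Proof.
rewrite /rat_bits -[n%:R]/(n%:Z%:Q) numq_int denq_int /=.
by rewrite [nat_bits 1](_ : _ = 1%N) // /nat_bits; lia.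
Qed.

(** The two bits taken off [b] are the sign and the denominator 1. *)
Lemma representable_nat (R : realType) m b (f : {set 'I_m} -> nat) :
  (forall S, f S < 2 ^ (b - 2))%N -> (2 <= b)%N ->
  representable b [ffun S => (f S)%:R : R].
Proof.
move=> fb b2 S; exists (f S)%:R; first by rewrite ffunE ratr_nat.
rewrite rat_bits_nat -(subnKC b2) leq_add2l.
exact: up_log_min.
Qed.

Lemma perturbed_quadratic_le m (M : {set 'I_m}) h S :
  (perturbed_quadratic M h S <= 2 * m ^ 2 + 1)%N.
Proof.
have Xm : (#|S :&: M| <= m)%N by rewrite -[m in leqRHS]card_ord max_card.
by rewrite /perturbed_quadratic; case: (h _) => /=; nia.
Qed.

Lemma quadratic_lt_exp2 m : (12 <= m)%N -> (2 * m ^ 2 + 1 < 2 ^ (m - 2))%N.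
Proof.
move=> /subnKC <-; have -> : (12 + (m - 12) - 2 = 10 + (m - 12))%N by [].
elim: (m - 12)%N => [//|d]; have -> : (2 ^ (10 + d.+1) = 2 * 2 ^ (10 + d))%N.
  by rewrite addnS expnS.
by move: (2 ^ (10 + d))%N => e; nia.
Qed.

(** The leading coefficient is a positive natural, so for [m > 0] the leading term alone reaches
    [m]. Thus a budget of [q.[m]] bits covers utilities that fit in [m] bits. *)
Lemma horner_nat_ge (q : {poly nat}) m : (1 < size q)%N -> (m <= q.[m])%N.
Proof.
case: m => [//|m]; rewrite horner_coef; case E : (size q) => [//|[//|n]] _.
rewrite big_ord_recr /=; apply: leq_trans (leq_addl _ _).
have : q`_n.+1 != 0%N.
  have := lead_coef_eq0 q; rewrite lead_coefE E /= => ->.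
  by rewrite -size_poly_gt0 E.
rewrite -lt0n exprS => c0.
have e0 : (0 < (m.+1 ^+ n)%R)%N.
  elim: n {E c0} => [//|n IH]; rewrite exprS.
  by change (0 < m.+1 * (m.+1 ^+ n)%R)%N; rewrite muln_gt0.
change (m.+1 <= (q`_n.+1)%R * (m.+1 * (m.+1 ^+ n)%R))%N.
by rewrite mulnCA leq_pmulr // muln_gt0 c0.
Qed.

(** * The hard family of utilities *)

(** The item [i0] selects one set from each complementary pair in [M]: the set avoiding [i0] is
    looked up in [G], and the other gets the opposite answer. *)
Definition good m (M : {set 'I_m}) (i0 : 'I_m) (G : {set {set 'I_m}})
    (S : {set 'I_m}) : bool :=
  if i0 \in S then M :\: S \notin G else S \in G.

Lemma good_complement m (M : {set 'I_m}) i0 G (S : {set 'I_m}) :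
  i0 \in M -> S \subset M -> good M i0 G (M :\: S) = ~~ good M i0 G S.
Proof.
move=> i0M SM; rewrite /good !inE i0M andbT; case: (i0 \in S) => /=.
  by rewrite negbK.
by rewrite setDDr setDv set0U (setIidPr SM).
Qed.

(** If both bundles have [n] items in [M], they split [M] and only one bonus is paid. Otherwise the
    quadratic part loses at least 1, which offsets one of the at most two bonuses. *)
Lemma hard_welfare m n (M : {set 'I_m}) i0 G (B1 B2 : {set 'I_m}) :
  #|M| = n.*2 -> i0 \in M -> [disjoint B1 & B2] ->
  (perturbed_quadratic M (good M i0 G) B1 + perturbed_quadratic M (good M i0 G) B2
     <= 2 * (n * (2 * m - n)) + 1)%N.
Proof.
move=> cM i0M B12; rewrite /perturbed_quadratic.
have B1M : B1 :&: M \subset M by apply: subsetIr.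
have B2M : B2 :&: M \subset M :\: (B1 :&: M).
  apply/subsetP => z; rewrite !inE => /andP[z2 zM]; rewrite zM !andbT.
  by have := disjointFl B12 z2 => ->.
move: (B1 :&: M) (B2 :&: M) B1M B2M => X Y XM YM.
have cX : (#|X| + #|M :\: X| = n.*2)%N by rewrite -cM -(cardsID X M) (setIidPr XM).
have cY := subset_leq_card YM.
have Mm : (#|M| <= m)%N by rewrite -[m in leqRHS]card_ord max_card.
have M0 : (0 < #|M|)%N by apply/card_gt0P; exists i0.
rewrite cM in Mm M0.
have [/andP[/eqP Xn /eqP Yn]|ne] := boolP ((#|X| == n) && (#|Y| == n)).
  have -> : Y = M :\: X by apply/eqP; rewrite eqEcard YM Yn; lia.
  rewrite good_complement // Xn.
  have -> : #|M :\: X| = n by lia.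
  by case: (good _ _ _ _) => /=; lia.
have : (#|X| * (2 * m - #|X|) + #|Y| * (2 * m - #|Y|) + 1 <= 2 * (n * (2 * m - n)))%N.
  have XY : (#|X| + #|Y| <= n.*2)%N by lia.
  have ne' : (#|X| != n) || (#|Y| != n) by rewrite -negb_and.
  move: #|X| #|Y| XY ne' => x y XY ne'; rewrite -addnn in XY Mm M0.
  (* With [x = n + a], [y = n + c] and [2 * m - n = n + d], the quadratic part exceeds its value at
     [(n, n)] by [d * (a + c) - a ^ 2 - c ^ 2], where [a + c <= 0] and [a], [c] are not both 0. *)
  have [a def_a] : exists a : int, x%:Z = n%:Z + a by exists (x%:Z - n%:Z); lia.
  have [c def_c] : exists c : int, y%:Z = n%:Z + c by exists (y%:Z - n%:Z); lia.
  have [d def_d] : exists d, (2 * m - n = n + d)%N /\ (0 < d)%N.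
    by exists (2 * m - n - n)%N; lia.
  nia.
by case: (good _ _ _ _); case: (good _ _ _ _) => /=; lia.
Qed.

Lemma hard_partition m n (M : {set 'I_m}) i0 G G' :
  #|M| = n.*2 ->
  G \in powerset [set S : {set 'I_m} | (S \subset M :\ i0) && (#|S| == n)] ->
  G' \in powerset [set S : {set 'I_m} | (S \subset M :\ i0) && (#|S| == n)] ->
  i0 \in M -> G != G' ->
  exists S : {set 'I_m},
    perturbed_quadratic M (good M i0 G) S = (n * (2 * m - n) + 1)%N /\
    perturbed_quadratic M (good M i0 G') (~: S) = (n * (2 * m - n) + 1)%N.
Proof.
move=> cM GD G'D i0M neG.
have half (S : {set 'I_m}) : S \subset M -> #|S| = n ->
    good M i0 G S -> ~~ good M i0 G' S ->
    perturbed_quadratic M (good M i0 G) S = (n * (2 * m - n) + 1)%N /\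
    perturbed_quadratic M (good M i0 G') (~: S) = (n * (2 * m - n) + 1)%N.
  move=> SM Sn GS G'S; rewrite /perturbed_quadratic (setIidPl SM) Sn GS.
  rewrite setIC -setDE good_complement // G'S; split=> //.
  by rewrite cardsD (setIidPr SM) cM Sn -addnn addnK.
have [S SGG'] : exists S, (S \in G) != (S \in G').
  apply/existsP; apply: contraR neG; rewrite negb_exists => /forallP GG'.
  by apply/eqP/setP => S; apply/eqP; have := GG' S; rewrite negbK.
have /andP[SM /eqP Sn] : (S \subset M :\ i0) && (#|S| == n).
  move: SGG' GD G'D; rewrite !inE => + /subsetP/(_ S) + /subsetP/(_ S).
  rewrite inE; case: (S \in G); case: (S \in G') => // _ h1 h2.
    exact: h1.
  exact: h2.
have /andP[SM' i0S] : (S \subset M) && (i0 \notin S) by rewrite -subsetD1.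
have goodE H : good M i0 H S = (S \in H) by rewrite /good (negbTE i0S).
(* The first player needs a [G]-good half that is not [G']-good: [S] itself if [S] is in [G], and
   [M :\: S] if [S] is in [G']. *)
have [SG|SG] := boolP (S \in G).
  exists S; apply: half; rewrite ?goodE //.
  by move: SGG'; rewrite SG; case: (S \in G').
exists (M :\: S); apply: half; rewrite ?subsetDl ?good_complement ?goodE //.
  by rewrite cardsD (setIidPr SM') cM Sn -addnn addnK.
by move: SGG'; rewrite (negbTE SG) negbK; case: (S \in G').
Qed.

(** * Counting families and the final bound *)

(** Two Pascal expansions and the symmetry of the middle row double the bound at each step. *)
Lemma bin_middle_ge n : (2 ^ n <= 'C(n.*2.+1, n.+1))%N.
Proof.
elim: n => [//|n IH]; rewrite doubleS expnS.
have sym : 'C(n.*2.+1, n) = 'C(n.*2.+1, n.+1).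
  by rewrite -bin_sub; [congr 'C(_, _)|]; rewrite -addnn; lia.
by rewrite (binS n.*2.+2) (binS n.*2.+1 n.+1) (binS n.*2.+1 n) sym; lia.
Qed.

Lemma hard_instance_bits (R : realType) (m k b : nat) (A : 'I_k -> allocation m)
    (P : protocol (utility R m) (mixed_allocation R k)) :
  (12 <= m)%N -> (m <= b)%N -> allowable A -> calculates_PE_EF A b P ->
  exists u : player -> utility R m,
    instance b u /\ (2 ^ (m./2).-1 <= bits_exchanged P u)%N.
Proof.
move=> m12 mb [Adisj Apart] calc; set n := m./2.
have n2m : (n.*2 <= m)%N by rewrite -[leqRHS](odd_double_half m) leq_addl.
pose M := [set i : 'I_m | (i < n.*2)%N].
pose i0 : 'I_m := Ordinal (leq_trans (isT : (0 < 12)%N) m12).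
have cM : #|M| = n.*2.
  have inj : injective (widen_ord n2m) by move=> i j /(congr1 val) ij; apply: val_inj.
  rewrite -[RHS]card_ord -(card_imset _ inj).
  apply: eq_card => i; rewrite !inE; apply/idP/imsetP => [lt_i|[j _ ->]]; last exact: ltn_ord j.
  by exists (Ordinal lt_i) => //; apply: val_inj.
have i0M : i0 \in M by rewrite inE /= double_gt0 half_gt0; lia.
pose D := [set S : {set 'I_m} | (S \subset M :\ i0) && (#|S| == n)].
pose v (G : {set {set 'I_m}}) : utility R m :=
  [ffun S => (perturbed_quadratic M (good M i0 G) S)%:R].
pose x G := profile (v G) (v G).
have xI G : instance b (x G).
  move=> i; rewrite /x /profile if_same; split.
    exact: submodular_perturbed_quadratic.
  apply: representable_nat => [S|]; last by lia.
  apply: leq_ltn_trans (perturbed_quadratic_le _ _ _) _.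
  by apply: leq_trans (quadratic_lt_exp2 m12) _; rewrite leq_exp2l // leq_sub2r.
have cD : (2 ^ n.-1 <= #|D|)%N.
  have n0 : (0 < n)%N by rewrite half_gt0; lia.
  have cMi : #|M :\ i0| = n.*2.-1 by rewrite -cM [in RHS](cardsD1 i0) i0M.
  rewrite [#|D|]cards_draws cMi; case: (n) n0 => // n' _.
  by rewrite doubleS; apply: bin_middle_ge.
(* Either some family already costs [#|D|] bits, or all [2 ^ #|D|] families cost at most [#|D|.-1]
   and two of them collide. *)
have [G /andP[_ bG]|small] :=
    pickP [pred G in powerset D | (#|D| <= bits_exchanged P (x G))%N].
  by exists (x G); split=> //; apply: leq_trans cD bG.
have D0 : (0 < #|D|)%N by apply: leq_trans cD; rewrite expn_gt0.
have [||G [G' [GD G'D neG tGG']]] :=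
    @transcript_collision _ _ _ x P (#|D|).-1 (powerset D).
- by move=> G GD; have := small G; rewrite /= GD /= => /negbT; rewrite -ltnNge; lia.
- by rewrite card_powerset ltn_exp2l // ltn_predL.
have [p [pp efG efG' pe]] := calculates_same_transcript calc (xI G) (xI G') tGG'.
pose W : R := (2 * (n * (2 * m - n)) + 1)%:R.
have upper H i : envy_free A (x H) p -> 2 * expected A p (v H) i <= W.
  move=> ef; apply: envy_free_common_utility ef _ => // j.
  by rewrite !ffunE -natrD ler_nat; apply: hard_welfare => //; apply: Adisj.
have [S [SG SG']] := hard_partition cM GD G'D i0M neG.
have [|j Aj] := Apart (profile S (~: S)).
  split.
    move=> i i'; rewrite /profile.
    case: (player_case i) => ->; case: (player_case i') => -> //= _.
      by rewrite disjoints_subset setCK.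
    by rewrite disjoints_subset.
  by rewrite big_ord_recl big_ord1 /profile /= setUCr.
(* The partition pays each player [(W + 1) / 2], while the common lottery pays at most [W / 2]. *)
case: (pareto_efficient_pure (j := j) pe) => i.
have lt H B : perturbed_quadratic M (good M i0 H) B = (n * (2 * m - n) + 1)%N ->
    envy_free A (x H) p -> expected A p (v H) i < v H B.
  move=> HB /upper-/(_ i); rewrite ffunE HB /W natrD [X in _ -> _ < X]natrD natrM.
  by lra.
by rewrite Aj; case: (player_case i) lt => -> lt; apply: lt.
Qed.

Theorem theorem3p2 (R : realType) (q : {poly nat}) (hq : (1 < size q)%N) :
  exists a : R, 1 < a /\
    exists m0 : nat, forall m : nat, (m0 <= m)%N ->
      forall (k : nat) (A : 'I_k -> allocation m), allowable A ->
      forall P : protocol (utility R m) (mixed_allocation R k),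
        calculates_PE_EF A q.[m] P ->
        exists u : player -> utility R m,
          instance q.[m] u /\ a ^+ m <= (bits_exchanged P u)%:R.
Proof.
(* The base 9/8 works because its fourth power is below 2 and [m <= 4 * (m./2).-1] once
   [m >= 12]. *)
have a1 : 1 < 9%:R / 8%:R :> R by lra.
exists (9%:R / 8%:R); split=> //; exists 12 => m m12 k A hA P calc.
have [u [iu bu]] := hard_instance_bits m12 (horner_nat_ge m hq) hA calc.
exists u; split=> //.
apply: le_trans (_ : (2 ^ (m./2).-1)%:R <= _); last by rewrite ler_nat.
have hm : (m <= 4 * (m./2).-1)%N.
  rewrite -[X in (X <= _)%N](odd_double_half m).
  by have := half_leq m12; case: (odd m) => /=; lia.
apply: le_trans (ler_weXn2l (ltW a1) hm) _.
rewrite exprM natrX lerXn2r ?nnegrE //; lra.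
Qed.
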